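(* For any barcode $B$ with $n^B\ge 2$ bars and total persistence $L^B>0$, $$H_2(B)=-\log\left(\frac{1}{n^B}+\frac{n^B-1}{(n^B)^2}\,cv\mathrm{TSI}(B)\right).$$ Equivalently, $$cv\mathrm{TSI}(B)=\frac{(n^B)^2}{n^B-1}\left(e^{-H_2(B)}-\frac{1}{n^B}\right).$$
   Context: A barcode $B=\{[b_i,d_i)\}_{i=1}^{n^B}$ is a finite multiset of bars, each given by its pair of real endpoints $b_i\le d_i$ (zero-length bars are allowed); $n^B$ is the number of bars counted with multiplicity, $\ell_i=d_i-b_i\ge 0$ are the bar lengths (lifetimes), and $L^B=\sum_{i=1}^{n^B}\ell_i$ is the total persistence. The Topological Stability Index is the unbiased sample variance of the lifetimes: $\mathrm{TSI}(B)=\frac{1}{n^B-1}\sum_{i=1}^{n^B}\left(\ell_i-\frac{L^B}{n^B}\right)^2$ for $n^B\ge 2$, and $\mathrm{TSI}(B)=0$ if $n^B\le 1$. For $n^B\ge 1$ and $L^B>0$, the normalized Topological Stability Index is $cv\mathrm{TSI}(B)=\mathrm{TSI}(B)/(L^B/n^B)^2$. With weights $p_i=\ell_i/L^B$, the Rényi entropy of order two of $B$ is $H_2(B)=-\log\left(\sum_{i=1}^{n^B}p_i^2\right)$ (natural logarithm). *)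

(* Defs.v *)
From mathcomp Require Import all_boot all_order all_algebra.
From mathcomp Require Import finmap multiset.
From mathcomp Require Import reals sequences exp.

Set Implicit Arguments.
Unset Strict Implicit.
Unset Printing Implicit Defensive.

Import Order.TTheory GRing.Theory Num.Theory.

Local Open Scope ring_scope.

(* The pair (b, d) stands for the interval [b, d); b = d is allowed. *)
Definition bar (R : realType) := {x : R * R | x.1 <= x.2}.

Definition barcode (R : realType) := {mset bar R}%mset.

Identity Coercion multiset_of_barcode : barcode >-> multiset_of.

Section Barcode.
Variable R : realType.
Implicit Types (x : bar R) (B : barcode R).

Definition birth x : R := (val x).1.

Definition death x : R := (val x).2.

Definition lifetime x : R := death x - birth x.

(* A multiset coerces to the sequence that lists every element as often as its
   multiplicity, so [size B] and the sums below count repeated bars. *)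
Definition nbars B : nat := size B.

Definition total_persistence B : R := \sum_(x <- B) lifetime x.

Definition TSI B : R :=
  if (nbars B <= 1)%N then 0
  else ((nbars B)%:R - 1)^-1 *
       \sum_(x <- B) (lifetime x - total_persistence B / (nbars B)%:R) ^+ 2.

Definition cvTSI B : R :=
  TSI B / (total_persistence B / (nbars B)%:R) ^+ 2.

Definition weight B x : R :=
  lifetime x / total_persistence B.

Definition renyi2 B : R := - ln (\sum_(x <- B) weight B x ^+ 2).

End Barcode.

(* Main.v *)
Require Import Defs.
From mathcomp Require Import all_boot all_order all_algebra.
From mathcomp Require Import finmap multiset.
From mathcomp Require Import reals sequences exp.
From mathcomp Require Import ring.

Import Order.TTheory GRing.Theory Num.Theory.

Local Open Scope ring_scope.

(** The sum of the squared weights and the normalized index are both affine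
    functions of the second moment [S] of the lifetimes. With [n] bars and
    total persistence [L], the squared weights sum to [S / L ^ 2], and since
    the squared deviations from the mean sum to [S - L ^ 2 / n], the index is
    [n ^ 2 / (n - 1) * (S / L ^ 2 - 1 / n)]. Eliminating [S / L ^ 2] gives the
    identity [sum_sqr_weight], and the first formula is its logarithm. For the
    second one, the logarithm has to be inverted; this is legitimate because
    the sum of the squared weights is at least [1 / n], the index being
    nonnegative. *)

(** For [n] terms of sum [L] and mean [m = L / n], expanding the squares gives
    cross terms adding up to [-2 m L = -2 L ^ 2 / n], and the constant terms
    contribute [n m ^ 2 = L ^ 2 / n]. *)
Lemma sum_sqr_dev_mean (F : numFieldType) (T : Type) (s : seq T) (f : T -> F) :
  \sum_(x <- s) (f x - (\sum_(y <- s) f y) / (size s)%:R) ^+ 2 =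
  \sum_(x <- s) f x ^+ 2 - (\sum_(x <- s) f x) ^+ 2 / (size s)%:R.
Proof.
(* Over the empty sequence, the mean is [0 / 0 = 0] and both sides vanish. *)
case: s => [|x0 s]; first by rewrite !big_nil expr0n mul0r subr0.
set t := x0 :: s; set L := \sum_(y <- t) f y.
have n0 : (size t)%:R != 0 :> F by rewrite pnatr_eq0.
under eq_bigr => x _ do rewrite sqrrB.
rewrite big_split sumrB sumrMnl -mulr_suml -/L.
rewrite big_const_seq count_predT iter_addr_0 /= -[_ ^+ 2 *+ _]mulr_natr.
move: (_%:R) n0 => n n0.
by field.
Qed.

Lemma TSI_ge0 (R : realType) (B : barcode R) : 0 <= TSI B.
Proof.
rewrite /TSI; case: leqP => // n1.
apply: mulr_ge0; first by rewrite invr_ge0 subr_ge0 ler1n ltnW.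
by apply: sumr_ge0 => x _; exact: sqr_ge0.
Qed.

Lemma cvTSI_ge0 (R : realType) (B : barcode R) : 0 <= cvTSI B.
Proof. by rewrite mulr_ge0 ?TSI_ge0 // invr_ge0 sqr_ge0. Qed.

Lemma sum_sqr_weight (R : realType) (B : barcode R)
  (nB : (2 <= nbars B)%N) (LB : 0 < total_persistence B) :
  \sum_(x <- B) weight B x ^+ 2 =
  1 / (nbars B)%:R + ((nbars B)%:R - 1) / (nbars B)%:R ^+ 2 * cvTSI B.
Proof.
have L0 : total_persistence B != 0 by rewrite gt_eqF.
have n0 : (nbars B)%:R != 0 :> R by rewrite pnatr_eq0 -lt0n ltnW.
have n1 : (nbars B)%:R - 1 != 0 :> R by rewrite subr_eq0 pnatr_eq1 gtn_eqF.
under eq_bigr => x _ do rewrite /weight expr_div_n.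
rewrite -mulr_suml /cvTSI /TSI leqNgt nB /=.
rewrite sum_sqr_dev_mean -/(total_persistence B) -/(nbars B).
by field; rewrite L0 n0 n1.
Qed.

Lemma sum_sqr_weight_gt0 (R : realType) (B : barcode R)
  (nB : (2 <= nbars B)%N) (LB : 0 < total_persistence B) :
  0 < \sum_(x <- B) weight B x ^+ 2.
Proof.
rewrite sum_sqr_weight //; apply: ltr_pwDl.
  by rewrite divr_gt0 // ltr0n ltnW.
by rewrite mulr_ge0 ?cvTSI_ge0 // divr_ge0 ?sqr_ge0 // subr_ge0 ler1n ltnW.
Qed.

Theorem corollary3p3 (R : realType) (B : barcode R)
  (nB : (2 <= nbars B)%N) (LB : 0 < total_persistence B) :
  renyi2 B =
    - ln (1 / (nbars B)%:R
          + ((nbars B)%:R - 1) / (nbars B)%:R ^+ 2 * cvTSI B)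
  /\
  cvTSI B =
    (nbars B)%:R ^+ 2 / ((nbars B)%:R - 1)
    * (expR (- renyi2 B) - 1 / (nbars B)%:R).
Proof.
split; first by rewrite /renyi2 sum_sqr_weight.
rewrite /renyi2 opprK lnK ?posrE ?sum_sqr_weight_gt0 // sum_sqr_weight //.
have n0 : (nbars B)%:R != 0 :> R by rewrite pnatr_eq0 -lt0n ltnW.
have n1 : (nbars B)%:R - 1 != 0 :> R by rewrite subr_eq0 pnatr_eq1 gtn_eqF.
by field; rewrite n0 n1.
Qed.
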